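(* Let $\mathfrak{g}$ be an $n$-dimensional non-model complex filiform Lie algebra with associated triple $(z_1,z_2,n)$. Then there exist an adapted basis $\{e_1,\ldots,e_n\}$ of $\mathfrak{g}$ and complex numbers $\alpha_i$, $\gamma_j$ and $\beta_{k\ell}$, with $1\le i\le z_2-z_1+1$, $1\le j\le n-z_2-1$, $2\le\ell\le n-z_2$ and $1\le k<z_2-z_1+\ell$, such that $$[e_1,e_h]=e_{h-1}\quad\text{for } 3\le h\le n,$$ $$[e_{z_1+i},e_{z_2+1}]=\alpha_1e_{i+2}+\alpha_2e_{i+1}+\cdots+\alpha_{i+1}e_2\quad\text{for } 0\le i\le z_2-z_1,$$ $$[e_{z_1},e_{z_2+j}]=\alpha_1e_{j+1}+\gamma_1e_j+\cdots+\gamma_{j-1}e_2\quad\text{for } 2\le j\le n-z_2,$$ $$[e_{z_1+k},e_{z_2+\ell}]=\sum_{h=2}^{k+\ell}P_h\big([e_{z_1+k-1},e_{z_2+\ell}]+[e_{z_1+k},e_{z_2+\ell-1}]\big)e_{h+1}+\beta_{k\ell}\,e_2\quad\text{for } 2\le\ell\le n-z_2,\ 1\le k<z_2-z_1+\ell.$$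
   Context: All Lie algebras are finite-dimensional over $\mathbb{C}$. The lower central series is $C^1\mathfrak{g}=\mathfrak{g}$, $C^k\mathfrak{g}=[C^{k-1}\mathfrak{g},\mathfrak{g}]$ for $k\ge 2$. An $n$-dimensional Lie algebra $\mathfrak{g}$ is filiform if $\dim C^k\mathfrak{g}=n-k$ for all $2\le k\le n$. A basis $\{e_1,\ldots,e_n\}$ of an $n$-dimensional filiform Lie algebra is called adapted if $[e_1,e_h]=e_{h-1}$ for $3\le h\le n$, $[e_2,e_h]=0$ for $1\le h\le n$, and $[e_3,e_h]=0$ for $2\le h\le n$. Every filiform Lie algebra admits an adapted basis. A filiform Lie algebra is called model if, with respect to an adapted basis, its only nonzero brackets are $[e_1,e_h]=e_{h-1}$, $3\le h\le n$ (up to skew-symmetry); this does not depend on the adapted basis. Every filiform Lie algebra of dimension $\le 4$ is model. For a non-model $n$-dimensional filiform Lie algebra with adapted basis $\{e_1,\dots,e_n\}$, put $z_1=\min\{k\ge 4 : [e_k,e_n]\ne 0\}$ and $z_2=\min\{k\ge4 : [e_k,e_{k+1}]\ne0\}$. These are invariants (independent of the adapted basis) and satisfy $4\le z_1\le z_2<n\le 2z_2-2$; the triple $(z_1,z_2,n)$ is called the triple associated with $\mathfrak{g}$. For a basis $\{e_1,\ldots,e_n\}$, $P_h:\mathfrak{g}\to\mathbb{C}$ denotes the linear map giving the $h$-th coordinate, so $u=\sum_{h=1}^nP_h(u)e_h$ for all $u\in\mathfrak{g}$. *)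

(* Defs.v *)
From HB Require Import structures.
From mathcomp Require Import all_boot all_order all_algebra.
From mathcomp Require Import reals complex.

Set Implicit Arguments.
Unset Strict Implicit.
Unset Printing Implicit Defensive.

Import Order.TTheory GRing.Theory Num.Theory.
Local Open Scope ring_scope.

HB.mixin Record Vector_isLieAlgebra (K : fieldType) (V : Type)
    of Vector K V := {
  lie : V -> V -> V;
  lie_is_linearl : forall y, linear (fun x => lie x y);
  lie_is_linearr : forall x, linear (lie x);
  liexx : forall x, lie x x = 0;
  lie_jacobi : forall x y z,
    lie x (lie y z) + lie y (lie z x) + lie z (lie x y) = 0
}.

#[short(type="lieAlgType")]
HB.structure Definition LieAlgebra (K : fieldType) :=
  { V of Vector K V & Vector_isLieAlgebra K V }.

Section LieTheory.
Variables (K : fieldType) (g : lieAlgType K).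
Implicit Types (x y : g) (U V W : {vspace g}).

HB.instance Definition _ x := GRing.isLinear.Build K g g *:%R (lie x)
  (lie_is_linearr x).

Definition lier y x : g := lie x y.
HB.instance Definition _ y := GRing.isLinear.Build K g g *:%R (lier y)
  (lie_is_linearl y).

(* [U, V]: the span of the brackets of basis vectors, which by bilinearity is
   the span of all lie x y with x in U and y in V; see lie_subvP. *)
Definition lie_vspace U V : {vspace g} :=
  <<[seq lie x y | x <- vbasis U, y <- vbasis V]>>%VS.

Lemma memv_lie U V x y : x \in U -> y \in V -> lie x y \in lie_vspace U V.
Proof.
move=> xU yV; rewrite (coord_vbasis yV) linear_sum memv_suml // => j _.
rewrite linearZ memvZ //= -[lie _ _]/(lier _ _) (coord_vbasis xU) linear_sum.
rewrite memv_suml // => i _; rewrite linearZ memvZ //=.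
by apply: memv_span; apply: allpairs_f; rewrite mem_nth // size_tuple.
Qed.

Lemma lie_subvP U V W :
  reflect (forall x y, x \in U -> y \in V -> lie x y \in W)
          (lie_vspace U V <= W)%VS.
Proof.
apply: (iffP idP) => [sW x y xU yV | h].
  by apply: (subvP sW); apply: memv_lie.
by apply/span_subvP => _ /allpairsP[[x y] /= [xU yV ->]]; apply: h;
  apply: vbasis_mem.
Qed.

(* Indexed from 1: lower_central 1 is the whole algebra; the value at 0 is
   not meaningful. *)
Definition lower_central (k : nat) : {vspace g} :=
  iter k.-1 (fun U => lie_vspace U fullv) fullv.

Definition filiform (n : nat) : Prop :=
  \dim {:g} = n /\
  forall k, (2 <= k <= n)%N -> \dim (lower_central k) = (n - k)%N.

Section Bases.
Variable n : nat.
Implicit Types (e : n.-tuple g) (h : nat).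

(* The vector e_h of the family e_1, ..., e_n, numbered from 1; it is 0 when
   h is not in {1, ..., n}. *)
Definition evec e h : g := if h is h'.+1 then e`_h' else 0.

(* The coordinate P_h with respect to e_1, ..., e_n, numbered from 1; it is 0
   when h is not in {1, ..., n}. *)
Definition ecoord e h (u : g) : K :=
  if h is h'.+1 then oapp (fun i : 'I_n => coord e i u) 0 (insub h') else 0.

Lemma ecoord_sum e u : basis_of fullv e ->
  u = \sum_(1 <= h < n.+1) ecoord e h u *: evec e h.
Proof.
move=> be; rewrite {1}(coord_basis be (memvf u)) big_add1 /= big_mkord.
by apply: eq_bigr => i _; rewrite /= valK.
Qed.

Definition adapted e : Prop :=
  [/\ basis_of fullv e,
      forall h, (3 <= h <= n)%N -> lie (evec e 1) (evec e h) = evec e h.-1,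
      forall h, (1 <= h <= n)%N -> lie (evec e 2) (evec e h) = 0
    & forall h, (2 <= h <= n)%N -> lie (evec e 3) (evec e h) = 0].

Definition only_model_brackets e : Prop :=
  forall i j, (1 <= i < j)%N -> (j <= n)%N ->
    lie (evec e i) (evec e j) != 0 -> i = 1%N /\ (3 <= j)%N.

End Bases.

Definition model (n : nat) : Prop :=
  exists e : n.-tuple g, adapted e /\ only_model_brackets e.

Definition is_least (P : nat -> Prop) (z : nat) : Prop :=
  P z /\ forall k, P k -> (z <= k)%N.

(* Both numbers are read off one and the same adapted basis. The bounds k <= n
   and k < n are implicit, since evec vanishes beyond n. *)
Definition associated_triple (z1 z2 n : nat) : Prop :=
  exists e : n.-tuple g,
    [/\ adapted e,
        is_least (fun k => (4 <= k)%N /\ lie (evec e k) (evec e n) <> 0) z1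
      & is_least (fun k => (4 <= k)%N /\ lie (evec e k) (evec e k.+1) <> 0) z2].

End LieTheory.

Arguments lower_central {K} g k.
Arguments filiform {K} g n.
Arguments model {K} g n.
Arguments associated_triple {K} g z1 z2 n.

(* Main.v *)
Require Import Defs.
From HB Require Import structures.
From mathcomp Require Import all_boot all_order all_algebra.
From mathcomp Require Import reals complex.
From mathcomp Require Import zify.

Set Implicit Arguments.
Unset Strict Implicit.
Unset Printing Implicit Defensive.

Import Order.TTheory GRing.Theory Num.Theory.
Local Open Scope ring_scope.
Local Open Scope complex_scope.

(** In an adapted basis, D = ad e_1 is the shift e_h -> e_(h-1), so that
    P_h (D u) = P_(h+1) u for all u and h >= 2 (lemma [ecoord_shift]).  Every
    bracket u lies in the derived algebra, whose dimension n - 2 forces it to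
    be spanned by e_2, ..., e_(n-1); hence P_1 u = 0 and u is determined by
    D u up to its coordinate P_2 u ([expand_shift]).  Since D is a derivation,
    D [e_a, e_b] = [e_(a-1), e_b] + [e_a, e_(b-1)], which gives the last
    family of brackets, with beta_kl = P_2 [e_(z1+k), e_(z2+l)], as soon as the
    sum is known to stop at h = k + l.

    The minimality of z1 says that e_2, ..., e_(z1-1) commute with e_n, and
    then by derivation with every e_b, b >= 2 ([lie_below_z1]); the minimality
    of z2 says that consecutive vectors among e_2, ..., e_z2 commute, and then
    that all of these vectors commute ([lie_below_z2]).  Starting from these
    zeros, induction on a + b bounds the degree of a bracket: [e_a, e_b] has no
    coordinate beyond a + b - z1 - z2 + 1 ([ecoord_lie_above]).  This is where
    the sums in the theorem stop.

    In the first two families of brackets one of the two summands of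
    D [e_a, e_b] vanishes, so D lowers a single index by one.  Iterating it
    carries every coordinate down to a P_2: the coefficients are
    alpha_m = P_2 [e_(z1+m-1), e_(z2+1)] and gamma_m = P_2 [e_z1, e_(z2+m+1)].
    Any adapted basis on which z1 and z2 can be read off thus has the stated
    form. *)

(** * Brackets as derivations *)

Section LieIdentities.
Variables (K : fieldType) (g : lieAlgType K).
Implicit Types x y z : g.

Lemma lie_antisym x y : lie x y = - lie y x.
Proof.
have lierD a b c : lie (a + b) c = lie a c + lie b c :> g.
  exact: (linearD (lier c)).
apply/eqP; rewrite -addr_eq0; apply/eqP.
have := liexx (x + y).
by rewrite lierD !linearD /= !liexx add0r addr0.
Qed.

Lemma lie_derivation x y z :
  lie x (lie y z) = lie (lie x y) z + lie y (lie x z).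
Proof.
have := lie_jacobi x y z.
rewrite [lie z (lie x y)]lie_antisym [lie z x]lie_antisym linearN /=.
by move/eqP; rewrite !subr_eq add0r => /eqP ->.
Qed.

End LieIdentities.

(** * Coordinates in an adapted basis *)

(* Keeps coordinates at successor indices folded. *)
Local Arguments ecoord : simpl never.
Local Arguments evec : simpl never.

Section Coordinates.
Variables (K : fieldType) (g : lieAlgType K) (n : nat) (e : n.-tuple g).

Lemma ecoord_is_linear h : linear (ecoord e h : g -> K^o).
Proof.
case: h => [|h] a x y; rewrite /ecoord; first by rewrite scaler0 addr0.
case: insubP => [i _ _|_] /=; last by rewrite scaler0 addr0.
by rewrite linearP.
Qed.

HB.instance Definition _ h :=
  GRing.isLinear.Build K g K^o *:%R (ecoord e h) (ecoord_is_linear h).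

Lemma evec_out h : (n < h)%N -> evec e h = 0.
Proof. by case: h => // h hn; rewrite /evec nth_default // size_tuple. Qed.

Lemma ecoord_out h u : (n < h)%N -> ecoord e h u = 0.
Proof. by case: h => // h hn; rewrite /ecoord insubF //; lia. Qed.

Lemma ecoord_evec h j : basis_of fullv e -> (0 < h <= n)%N ->
  ecoord e h (evec e j) = (h == j)%:R.
Proof.
move=> be; case: h => // h hn.
case: j => [|j]; first exact: linear0.
have [jn|nj] := ltnP j n; last first.
  by rewrite evec_out // linear0; case: eqP => // ?; lia.
rewrite /ecoord /evec; case: insubP => [i _ <-|]; last by case/negP; lia.
by rewrite /= (coord_free (Ordinal jn)) ?(basis_free be) // -val_eqE eq_sym.
Qed.

Hypothesis ad_e : adapted e.

Let be : basis_of fullv e. Proof. by case: ad_e. Qed.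

Lemma ad_evec h : (3 <= h <= n)%N -> lie (evec e 1) (evec e h) = evec e h.-1.
Proof. by case: ad_e => _ H _ _; apply: H. Qed.

Lemma lie_evec2 h : (1 <= h <= n)%N -> lie (evec e 2) (evec e h) = 0.
Proof. by case: ad_e => _ _ H _; apply: H. Qed.

Lemma lie_evec3 h : (2 <= h <= n)%N -> lie (evec e 3) (evec e h) = 0.
Proof. by case: ad_e => _ _ _ H; apply: H. Qed.

Lemma ad_lie_evec a b : (3 <= a <= n)%N -> (3 <= b <= n)%N ->
  lie (evec e 1) (lie (evec e a) (evec e b)) =
  lie (evec e a.-1) (evec e b) + lie (evec e a) (evec e b.-1).
Proof. by move=> ha hb; rewrite lie_derivation !ad_evec. Qed.

Lemma ecoord_shift h u : (2 <= h)%N ->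
  ecoord e h (lie (evec e 1) u) = ecoord e h.+1 u.
Proof.
move=> h2; have [nh|hn] := ltnP n h; first by rewrite !ecoord_out //; lia.
rewrite {1}(ecoord_sum u be) !linear_sum /=.
under eq_big_nat => j hj.
  rewrite !linearZ /=.
  have -> : ecoord e h (lie (evec e 1) (evec e j)) = (j == h.+1)%:R.
    have [j3|] := leqP 3 j; last first.
      case: j hj => [|[|[|//]]] hj _ //.
        by rewrite liexx linear0; case: eqP => //; lia.
      rewrite lie_antisym lie_evec2 ?oppr0 ?linear0; last by lia.
      by case: eqP => //; lia.
    rewrite ad_evec ?ecoord_evec //; try lia.
    by congr (_%:R); congr nat_of_bool; apply/eqP/eqP; lia.
  over.
have [hn'|nh] := ltnP h n; last first.
  rewrite [RHS]ecoord_out // big_nat big1 // => j hj.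
  by case: eqP => [?|_]; [lia | exact: mulr0].
rewrite (bigD1_seq h.+1) ?iota_uniq ?mem_index_iota //=.
rewrite eqxx [_ *: _]mulr1 big1 ?addr0 // => j /negPf ->; exact: mulr0.
Qed.

Lemma expand_from2 N u : ecoord e 1 u = 0 ->
  (forall h, (N <= h)%N -> ecoord e h u = 0) ->
  u = \sum_(2 <= h < N) ecoord e h u *: evec e h.
Proof.
move=> u1 uN; pose F h := ecoord e h u *: evec e h.
have hF M : (2 <= M)%N -> \sum_(1 <= h < M) F h = \sum_(2 <= h < M) F h.
  by move=> M2; rewrite big_ltn // {1}/F u1 scale0r add0r.
(* Both ranges are compared with the common longer one, up to M. *)
pose M := maxn 2 (maxn N n.+1).
have -> : \sum_(2 <= h < N) ecoord e h u *: evec e h = \sum_(2 <= h < M) F h.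
  have [N2|N2] := leqP N 2.
    rewrite big_geq // big_nat big1 // => h hh.
    by rewrite /F uN ?scale0r //; lia.
  rewrite [RHS](@big_cat_nat _ _ _ N) /=; [|lia..].
  rewrite [X in _ + X]big_nat [X in _ + X]big1 ?addr0 // => h hh.
  by rewrite /F uN ?scale0r //; lia.
rewrite -hF; last by lia.
rewrite {1}(ecoord_sum u be) [RHS](@big_cat_nat _ _ _ n.+1) /=; [|lia..].
rewrite [X in _ + X]big_nat [X in _ + X]big1 ?addr0 // => h hh.
by rewrite /F evec_out ?scaler0 //; lia.
Qed.

(** The kernel of ad e_1 is spanned by e_1 and e_2, so that without an
    e_1-component only the coefficient of e_2 escapes ad e_1. *)
Lemma expand_shift N u : ecoord e 1 u = 0 -> (2 <= N)%N ->
  (forall h, (N < h)%N -> ecoord e h u = 0) ->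
  u = \sum_(2 <= h < N) ecoord e h (lie (evec e 1) u) *: evec e h.+1
      + ecoord e 2 u *: evec e 2.
Proof.
move=> u1 N2 uN; rewrite {1}(@expand_from2 N.+1 u) // big_ltn // addrC.
congr (_ + _); rewrite big_add1 /=.
by apply: eq_big_nat => h hh; rewrite ecoord_shift //; lia.
Qed.

(** The vectors e_2, ..., e_(n-1) are brackets with e_1; being n - 2 in
    number, they span the derived algebra. *)
Lemma ecoord1_lie x y : filiform g n -> (2 <= n)%N -> ecoord e 1 (lie x y) = 0.
Proof.
move=> [_ fil] n2.
pose s := [seq evec e h.+2 | h <- iota 0 (n - 2)].
have free_s : free s.
  have -> : s = take (n - 2) (drop 1 e).
    apply: (@eq_from_nth _ 0); rewrite size_map size_iota.
      by rewrite size_takel // size_drop size_tuple; lia.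
    move=> i hi; rewrite (nth_map 0%N) ?size_iota // nth_iota //.
    by rewrite nth_take // nth_drop.
  have := basis_free be.
  rewrite -[X in free X](cat_take_drop 1) => /catr_free.
  by rewrite -[X in free X](cat_take_drop (n - 2)) => /catl_free.
have s_sub : (<<s>> <= lower_central g 2)%VS.
  apply/span_subvP => _ /mapP[h + ->]; rewrite mem_iota => hh.
  have -> : evec e h.+2 = - lie (evec e h.+3) (evec e 1).
    by rewrite -lie_antisym ad_evec //; lia.
  by rewrite memvN memv_lie ?memvf.
have eq_s : <<s>>%VS = lower_central g 2.
  apply/eqP; rewrite eqEdim s_sub fil ?n2 ?leqnn //=.
  by rewrite (eqnP free_s) size_map size_iota.
have : lie x y \in <<s>>%VS by rewrite eq_s memv_lie ?memvf.
move=> /(@coord_span _ _ _ (in_tuple s)) ->; rewrite linear_sum big1 // => i _.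
rewrite linearZ /= -[nth _ _ _]/(nth 0 s i) (nth_map 0%N) ?size_iota; last first.
  by rewrite -[X in (_ < X)%N](size_iota 0) -(size_map (fun h => evec e h.+2)).
by rewrite ecoord_evec ?[_ *: _]mulr0 //; lia.
Qed.

(** * Vanishing brackets and the degree of a bracket *)

(** Downward induction on b: [e_k, e_(b-1)] is the difference of
    ad e_1 [e_k, e_b] and [e_(k-1), e_b], both already known to vanish. *)
Lemma lie_below_z1 z1 :
  (forall k, (4 <= k < z1)%N -> lie (evec e k) (evec e n) = 0) ->
  forall k b, (2 <= k < z1)%N -> (2 <= b <= n)%N ->
  lie (evec e k) (evec e b) = 0.
Proof.
move=> Hz1 k b hk hb.
have [nk|kn] := ltnP n k.
  by rewrite evec_out // lie_antisym linear0 oppr0.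
have -> : b = (n - (n - b))%N by lia.
have : (n - b + 2 <= n)%N by lia.
elim: (n - b)%N k hk kn => [|d IH] k hk kn hd.
  rewrite subn0; have [k4|] := leqP 4 k; first by apply: Hz1; lia.
  case: k hk kn => [|[|[|[|//]]]] hk kn _ //; first by rewrite lie_evec2 //; lia.
  by rewrite lie_evec3 //; lia.
have [k3|k2] := leqP 3 k; last first.
  have -> : k = 2 by lia.
  by rewrite lie_evec2 //; lia.
have := @ad_lie_evec k (n - d)%N; rewrite !IH ?linear0 ?add0r; try lia.
have -> : (n - d).-1 = (n - d.+1)%N by lia.
by move=> <- //; lia.
Qed.

Lemma lie_below_z2 z2 : (z2 <= n)%N ->
  (forall k, (4 <= k < z2)%N -> lie (evec e k) (evec e k.+1) = 0) ->
  forall a b, (2 <= a <= z2)%N -> (2 <= b <= z2)%N ->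
  lie (evec e a) (evec e b) = 0.
Proof.
move=> z2n Hz2 a b ha hb.
wlog ab : a b ha hb / (a <= b)%N.
  move=> H; case/orP: (leq_total a b) => h; first exact: H.
  by rewrite lie_antisym H ?oppr0.
rewrite -(subnKC ab); have : (a + (b - a) <= z2)%N by lia.
(* The image of [e_(a+1), e_(a+c+2)] under ad e_1 relates the index differences
   c + 1, c + 2 and c, so two base cases are needed. *)
have [d] := ubnP (b - a)%N; elim: d a {b hb ab} (b - a)%N ha => // d IH a.
case=> [|[|c]] ha hc hac; first by rewrite addn0 liexx.
  rewrite addn1; have [a4|] := leqP 4 a; first by apply: Hz2; lia.
  case: a ha hac => [|[|[|[|//]]]] ha hac _ //; first by rewrite lie_evec2 //; lia.
  by rewrite lie_evec3 //; lia.
have := @ad_lie_evec a.+1 (a + c.+2)%N.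
have -> : lie (evec e a.+1) (evec e (a + c.+2)) = 0.
  have -> : (a + c.+2 = a.+1 + c.+1)%N by lia.
  by apply: IH; lia.
have -> : lie (evec e a.+1) (evec e (a + c.+2).-1) = 0.
  have -> : ((a + c.+2).-1 = a.+1 + c)%N by lia.
  by apply: IH; lia.
by rewrite linear0 addr0 /= => <- //; lia.
Qed.

(** If [e_a, e_b] is not known to vanish, then a and b are at least z1 and one
    of them exceeds z2.  The bound then leaves room for e_2, the direction in
    which ad e_1 loses information. *)
Lemma ecoord_lie_above z1 z2 : (2 <= z1)%N -> (z1 <= z2 <= n)%N ->
  (forall k, (4 <= k < z1)%N -> lie (evec e k) (evec e n) = 0) ->
  (forall k, (4 <= k < z2)%N -> lie (evec e k) (evec e k.+1) = 0) ->
  forall a b h, (2 <= a <= n)%N -> (2 <= b <= n)%N -> (2 <= h)%N ->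
  (a + b + 1 < h + z1 + z2)%N -> ecoord e h (lie (evec e a) (evec e b)) = 0.
Proof.
move=> z1_ge2 z12 Hz1 Hz2 a b h ha hb.
have [d] := ubnP (a + b)%N; elim: d a b h ha hb => // d IH a b h ha hb hd h2 hh.
have [az1|az1] := ltnP a z1.
  by rewrite (lie_below_z1 Hz1) ?linear0 //; lia.
have [bz1|bz1] := ltnP b z1.
  by rewrite lie_antisym (lie_below_z1 Hz1) ?oppr0 ?linear0 //; lia.
have [/andP[az2 bz2]|abz2] := boolP ((a <= z2) && (b <= z2))%N.
  by rewrite (lie_below_z2 _ Hz2) ?linear0 //; lia.
have [/andP[a3 b3]|ab3] := boolP ((3 <= a) && (3 <= b))%N.
  have -> : h = h.-1.+1 by lia.
  by rewrite -ecoord_shift ?ad_lie_evec ?linearD /= ?IH ?addr0 //; lia.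
have [-> | ->] : a = 2 \/ b = 2 by lia.
  by rewrite lie_evec2 ?linear0 //; lia.
by rewrite lie_antisym lie_evec2 ?oppr0 ?linear0 //; lia.
Qed.

End Coordinates.

(** * The brackets in terms of the associated triple *)

Theorem theorem2 (R : realType) (g : lieAlgType R[i]) (n z1 z2 : nat)
    (g_filiform : filiform g n) (g_nonmodel : ~ model g n)
    (g_triple : associated_triple g z1 z2 n) :
  exists (e : n.-tuple g) (alpha gamma : nat -> R[i])
         (beta : nat -> nat -> R[i]),
  adapted e /\
  [/\ (forall h : nat, (3 <= h <= n)%N ->
         lie (evec e 1) (evec e h) = evec e h.-1),
      (forall i : nat, (0 <= i <= z2 - z1)%N ->
         lie (evec e (z1 + i)%N) (evec e z2.+1) =
         \sum_(1 <= m < i.+2) alpha m *: evec e (i + 3 - m)%N),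
      (forall j : nat, (2 <= j <= n - z2)%N ->
         lie (evec e z1) (evec e (z2 + j)%N) =
         alpha 1%N *: evec e j.+1
         + \sum_(1 <= m < j) gamma m *: evec e (j.+1 - m)%N)
    & (forall k l : nat, (2 <= l <= n - z2)%N ->
         (1 <= k)%N -> (k < z2 - z1 + l)%N ->
         lie (evec e (z1 + k)%N) (evec e (z2 + l)%N) =
         \sum_(2 <= h < (k + l).+1)
           ecoord e h (lie (evec e (z1 + k - 1)%N) (evec e (z2 + l)%N)
                       + lie (evec e (z1 + k)%N) (evec e (z2 + l - 1)%N))
             *: evec e h.+1
         + beta k l *: evec e 2)].
Proof.
case: g_triple => e [ad_e [[z1_ge4 nz_z1] min1] [[z2_ge4 nz_z2] min2]].
have Hz1 k : (4 <= k < z1)%N -> lie (evec e k) (evec e n) = 0.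
  move=> /andP[k4 kz]; apply/eqP/negPn/negP => /eqP nz.
  by have := min1 k (conj k4 nz); lia.
have Hz2 k : (4 <= k < z2)%N -> lie (evec e k) (evec e k.+1) = 0.
  move=> /andP[k4 kz]; apply/eqP/negPn/negP => /eqP nz.
  by have := min2 k (conj k4 nz); lia.
have z2n : (z2 < n)%N.
  rewrite ltnNge; apply/negP => h; apply: nz_z2.
  by rewrite [evec e z2.+1]evec_out ?linear0.
have z12 : (z1 <= z2)%N.
  rewrite leqNgt; apply/negP => h; apply: nz_z2.
  by apply: (lie_below_z1 ad_e Hz1); lia.
have P1 x y : ecoord e 1 (lie x y) = 0 by apply: ecoord1_lie => //; lia.
have Pabove := ecoord_lie_above ad_e _ _ Hz1 Hz2.
pose P2 a b := ecoord e 2 (lie (evec e a) (evec e b)).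
(* s applications of ad e_1 lower z1 + i to z1 + i - s: the index z2 + 1 cannot
   be lowered, since z1 + i <= z2 and e_2, ..., e_z2 commute. *)
have down_i s i : (s <= i <= z2 - z1)%N ->
    ecoord e (s + 2) (lie (evec e (z1 + i)%N) (evec e z2.+1)) =
    P2 (z1 + i - s)%N z2.+1.
  elim: s i => [|s IH] i hi; first by rewrite subn0.
  rewrite addSn -ecoord_shift ?ad_lie_evec //; try lia.
  rewrite [X in _ + X](lie_below_z2 ad_e _ Hz2) ?addr0 /=; try lia.
  have -> : ((z1 + i).-1 = z1 + i.-1)%N by lia.
  by rewrite IH; [congr P2; lia | lia].
(* Here only the second index can be lowered: e_(z1-1) is central in the span
   of e_2, ..., e_n. *)
have down_j s j : (s < j <= n - z2)%N ->
    ecoord e (s + 2) (lie (evec e z1) (evec e (z2 + j)%N)) =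
    P2 z1 (z2 + j - s)%N.
  elim: s j => [|s IH] j hj; first by rewrite subn0.
  rewrite addSn -ecoord_shift ?ad_lie_evec //; try lia.
  rewrite [X in X + _](lie_below_z1 ad_e Hz1) ?add0r; try lia.
  have -> : ((z2 + j).-1 = z2 + j.-1)%N by lia.
  by rewrite IH; [congr P2; lia | lia].
exists e, (fun m => P2 (z1 + m - 1)%N z2.+1), (fun m => P2 z1 (z2 + m + 1)%N).
exists (fun k l => P2 (z1 + k)%N (z2 + l)%N).
split=> //; split.
- by case: ad_e.
- move=> i hi; rewrite [LHS](@expand_from2 _ _ _ _ ad_e (i + 3)) //; last first.
    by move=> h hh; apply: Pabove; lia.
  rewrite addn3 big_add1 big_nat_rev /=; apply: eq_big_nat => m hm.
  have -> : ((1 + i.+2 - m.+1).+1 = i.+3 - m)%N by lia.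
  have := down_i (i + 1 - m)%N i.
  have -> : (i + 1 - m + 2 = i.+3 - m)%N by lia.
  have -> : (z1 + i - (i + 1 - m) = z1 + m - 1)%N by lia.
  by move=> -> //; lia.
- move=> j hj; rewrite [LHS](@expand_from2 _ _ _ _ ad_e (j + 2)) //; last first.
    by move=> h hh; apply: Pabove; lia.
  rewrite addn2 big_add1 big_nat_rev /= big_ltn; last by lia.
  have -> : ((1 + j.+1 - 2).+1 = j.+1)%N by lia.
  have := down_j (j - 1)%N j.
  have -> : (j - 1 + 2 = j.+1)%N by lia.
  have -> : (z2 + j - (j - 1) = z2.+1)%N by lia.
  move=> ->; last by lia.
  rewrite addnK big_add1 /=; congr (_ + _); apply: eq_big_nat => m hm.
  have -> : ((1 + j.+1 - m.+2).+1 = j.+1 - m)%N by lia.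
  have := down_j (j - 1 - m)%N j.
  have -> : (j - 1 - m + 2 = j.+1 - m)%N by lia.
  have -> : (z2 + j - (j - 1 - m) = z2 + m + 1)%N by lia.
  by move=> -> //; lia.
- move=> k l hl hk hkl.
  rewrite [LHS](@expand_shift _ _ _ _ ad_e (k + l).+1) //; try lia; last first.
    by move=> h hh; apply: Pabove; lia.
  by rewrite ad_lie_evec ?subn1 //; lia.
Qed.
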